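(* (a) If $A \subseteq \mathbb{N}$ satisfies $\overline{d}(A) = 1$, then $R(A) = \{a/a' : a,a'\in A\}$ is dense in $\mathbb{Q}_p$ for every prime $p$. (b) For each $\alpha \in [0,1)$ there is a set $A \subseteq \mathbb{N}$ with $\underline{d}(A) \geq \alpha$ such that $R(A)$ is dense in $\mathbb{Q}_p$ for no prime $p$.
   Context: $\mathbb{N} = \{1,2,\ldots\}$. For $A\subseteq\mathbb{N}$, $\underline{d}(A) = \liminf_{n\to\infty} |A\cap[1,n]|/n$ and $\overline{d}(A) = \limsup_{n\to\infty} |A\cap[1,n]|/n$ are the lower and upper asymptotic densities. $\mathbb{Q}_p$ denotes the field of $p$-adic numbers with the $p$-adic metric. *)

(* Defs.v *)
From HB Require Import structures.
From mathcomp Require Import all_boot all_order all_algebra.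
From mathcomp Require Import generic_quotient ring_quotient.
From mathcomp Require Import all_classical all_reals all_analysis.
From mathcomp Require Import ring lra zify.

Set Implicit Arguments.
Unset Strict Implicit.
Unset Printing Implicit Defensive.

Import Order.TTheory GRing.Theory Num.Theory.
Import numFieldNormedType.Exports.

Local Open Scope classical_set_scope.
Local Open Scope ring_scope.

Definition padic_val (p : nat) (x : rat) : int :=
  (logn p `|numq x|%N)%:Z - (logn p `|denq x|%N)%:Z.

(* If p is not prime then logn p vanishes and padic_abs p is the trivial      *)
(* absolute value, so that everything below makes sense for every p.          *)
Definition padic_abs (p : nat) (x : rat) : rat :=
  if x == 0 then 0 else p%:R ^ (- padic_val p x).

Section PadicAbs.
Variable p : nat.
Local Notation abs := (padic_abs p).

Lemma padic_abs0 : abs 0 = 0. Proof. by rewrite /padic_abs eqxx. Qed.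

Lemma padic_abs_frac (m n : int) : m != 0 -> n != 0 ->
  abs (m%:~R / n%:~R) = p%:R ^ ((logn p `|n|%N)%:Z - (logn p `|m|%N)%:Z).
Proof.
move=> m0 n0; have nR0 : (n%:~R : rat) != 0 by rewrite intr_eq0.
have mR0 : (m%:~R : rat) != 0 by rewrite intr_eq0.
rewrite /padic_abs mulf_eq0 invr_eq0 (negPf nR0) (negPf mR0) /=.
set x := m%:~R / n%:~R; congr (_ ^ _).
have x0 : x != 0 by rewrite mulf_neq0 ?invr_eq0.
have e : numq x * n = denq x * m.
  apply/eqP; rewrite -(eqr_int rat) !intrM numqE /x.
  by apply/eqP; field.
have := congr1 (fun z => logn p `|z|%N) e.
rewrite /= !abszM !lognM ?absz_gt0 ?numq_eq0 ?denq_eq0 // /padic_val.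
move=> h; lia.
Qed.

Lemma padic_abs_ge0 x : 0 <= abs x.
Proof.
by rewrite /padic_abs; case: eqP => // _; rewrite exprz_ge0 // ler0n.
Qed.

Lemma padic_abs_eq0 x : (abs x == 0) = (x == 0).
Proof.
have [->|x0] := eqVneq x 0; first by rewrite padic_abs0 eqxx.
rewrite /padic_abs (negPf x0) /padic_val; apply: negPf.
have [p0|p0] := posnP p; last first.
  by apply: expfz_neq0; rewrite pnatr_eq0 -lt0n.
by rewrite p0.
Qed.

Lemma padic_abs_gt0 x : (0 < abs x) = (x != 0).
Proof. by rewrite lt0r padic_abs_eq0 padic_abs_ge0 andbT. Qed.

Lemma padic_absM x y : abs (x * y) = abs x * abs y.
Proof.
have [->|x0] := eqVneq x 0; first by rewrite !(mul0r, padic_abs0).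
have [->|y0] := eqVneq y 0; first by rewrite !(mulr0, padic_abs0).
have dx := denq_eq0 x; have dy := denq_eq0 y.
have E : x * y = (numq x * numq y)%:~R / (denq x * denq y)%:~R.
  by rewrite !intrM -{1}(divq_num_den x) -{1}(divq_num_den y) invfM mulrACA.
rewrite E padic_abs_frac ?mulf_neq0 ?numq_eq0 ?denq_eq0 //.
rewrite /padic_abs (negPf x0) (negPf y0) /padic_val.
have [pp|/negPf pp] := boolP (prime p); last first.
  by rewrite /logn pp !subrr !oppr0 !expr0z mulr1.
rewrite -expfzDr ?pnatr_eq0 -?lt0n ?prime_gt0 //.
rewrite !abszM !lognM ?absz_gt0 ?numq_eq0 ?denq_eq0 //; congr (_ ^ _); lia.
Qed.

Lemma padic_abs1 : abs 1 = 1.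
Proof.
have := padic_absM 1 1; rewrite mulr1 => h.
by apply: (@mulfI _ (abs 1)); rewrite ?padic_abs_eq0 ?oner_eq0 // -h mulr1.
Qed.

Lemma padic_absN x : abs (- x) = abs x.
Proof.
rewrite /padic_abs oppr_eq0 /padic_val numqN denqN abszN.
by [].
Qed.

Lemma padic_absV x : abs x^-1 = (abs x)^-1.
Proof.
have [->|x0] := eqVneq x 0; first by rewrite !(invr0, padic_abs0).
apply: (@mulfI _ (abs x)); rewrite ?padic_abs_eq0 // -padic_absM.
by rewrite !divff ?padic_abs_eq0 // padic_abs1.
Qed.

Lemma padic_abs_int (m : int) : m != 0 -> abs m%:~R = p%:R ^- logn p `|m|%N.
Proof.
move=> m0; have := @padic_abs_frac m 1 m0 isT.
by rewrite divr1 logn1 sub0r -exprnN.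
Qed.

Let padic_absD_int (m n : int) :
  abs (m%:~R + n%:~R) <= Num.max (abs m%:~R) (abs n%:~R).
Proof.
have [->|m0] := eqVneq m 0.
  by rewrite add0r padic_abs0 max_r // padic_abs_ge0.
have [->|n0] := eqVneq n 0.
  by rewrite addr0 padic_abs0 max_l // padic_abs_ge0.
rewrite -intrD; have [->|s0] := eqVneq (m + n) 0.
  by rewrite padic_abs0 le_max !padic_abs_ge0.
rewrite !padic_abs_int //.
have [pp|/negPf pp] := boolP (prime p); last first.
  by rewrite /logn pp !expr0 invr1 le_max lexx.
have p1 : 1 <= (p%:R : rat) by rewrite ler1n prime_gt0.
have p0 : 0 < (p%:R : rat) by rewrite ltr0n prime_gt0.
have key : (minn (logn p `|m|) (logn p `|n|) <= logn p `|(m + n)%R|)%N.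
  rewrite -pfactor_dvdn ?absz_gt0 //.
  have : ((p ^ minn (logn p `|m|) (logn p `|n|))%N%:Z %| m + n)%Z.
    apply: rpredD; rewrite dvdzE /= pfactor_dvdn ?absz_gt0 //.
      exact: geq_minl.
    exact: geq_minr.
  by rewrite dvdzE.
rewrite le_max !lef_pV2 ?posrE ?exprn_gt0 //.
move: key; rewrite geq_min => /orP[h|h]; apply/orP; [left|right];
  exact: ler_weXn2l.
Qed.

Lemma padic_absD x y : abs (x + y) <= Num.max (abs x) (abs y).
Proof.
set c : rat := (denq x)%:~R * (denq y)%:~R.
have c0 : c != 0 by rewrite mulf_neq0 ?intr_eq0 ?denq_eq0.
have Ex : x * c = (numq x * denq y)%:~R by rewrite intrM numqE mulrA.
have Ey : y * c = (numq y * denq x)%:~R by rewrite intrM numqE /c mulrCA mulrC.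
have cp : 0 < abs c by rewrite padic_abs_gt0.
rewrite -(ler_pM2r cp) maxr_pMl ?(ltW cp) // -!padic_absM mulrDl Ex Ey.
exact: padic_absD_int.
Qed.

Lemma padic_absB x y : abs (x - y) <= Num.max (abs x) (abs y).
Proof. by rewrite -[X in Num.max _ X]padic_absN padic_absD. Qed.

Lemma padic_abs_distC x y : abs (x - y) = abs (y - x).
Proof. by rewrite -padic_absN opprB. Qed.

Lemma padic_abs_eq_lt x y : abs (x - y) < abs x -> abs y = abs x.
Proof.
move=> h; apply/eqP; rewrite eq_le; apply/andP; split.
  have := padic_absB x (x - y); rewrite subKr => /le_trans -> //.
  by rewrite ge_max lexx ltW.
have := padic_absD (x - y) y; rewrite subrK le_max => /orP[|//].
by rewrite leNgt h.
Qed.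

End PadicAbs.

Definition padic_cauchy (p : nat) : {pred nat -> rat} := fun u =>
  `[< forall e : rat, 0 < e -> exists N : nat, forall m n : nat,
        (N <= m)%N -> (N <= n)%N -> padic_abs p (u m - u n) < e >].

Section PadicCauchy.
Variable p : nat.
Local Notation abs := (padic_abs p).

Lemma padic_cauchy_bounded u : u \in padic_cauchy p ->
  exists2 M : rat, 0 < M & exists N, forall n, (N <= n)%N -> abs (u n) <= M.
Proof.
move=> /asboolP /(_ 1 ltr01)[N uN]; exists (Num.max (abs (u N)) 1).
  by rewrite lt_max ltr01 orbT.
exists N => n Nn; have := padic_absD p (u n - u N) (u N); rewrite subrK.
move/le_trans; apply; rewrite ge_max !le_max lexx /= andbT orbC.
by rewrite ltW // uN.
Qed.

Lemma padic_cauchy_subring_closed : subring_closed (padic_cauchy p).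
Proof.
split=> [|u v /asboolP uC /asboolP vC|u v uP vP].
- by apply/asboolP => e e0; exists 0%N => m n _ _; rewrite subrr padic_abs0.
- apply/asboolP => e e0.
  have [[N uN] [M vM]] := (uC e e0, vC e e0).
  exists (maxn N M) => m n; rewrite !geq_max => /andP[Nm Mm] /andP[Nn Mn].
  have -> : (u - v) m - (u - v) n = (u m - u n) - (v m - v n).
    by rewrite !fctE; ring.
  by rewrite (le_lt_trans (padic_absB _ _ _)) // gt_max uN ?vM.
- have [[B B0 [N1 uB]] [C C0 [N2 vC]]] :=
    (padic_cauchy_bounded uP, padic_cauchy_bounded vP).
  apply/asboolP => e e0.
  have [N3 uN] := asboolP _ uP (e / C) (divr_gt0 e0 C0).
  have [N4 vN] := asboolP _ vP (e / B) (divr_gt0 e0 B0).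
  exists (maxn (maxn N1 N2) (maxn N3 N4)) => m n.
  rewrite !geq_max => /andP[/andP[? ?] /andP[? ?]] /andP[/andP[? ?] /andP[? ?]].
  have -> : (u * v) m - (u * v) n = u m * (v m - v n) + v n * (u m - u n).
    by rewrite !fctE; ring.
  rewrite (le_lt_trans (padic_absD _ _ _)) // gt_max !padic_absM.
  apply/andP; split.
    have := vN m n; rewrite ltr_pdivlMr // mulrC => h.
    rewrite (le_lt_trans _ (h _ _)) // ler_wpM2r ?padic_abs_ge0 //; exact: uB.
  have := uN m n; rewrite ltr_pdivlMr // mulrC => h.
  rewrite (le_lt_trans _ (h _ _)) // ler_wpM2r ?padic_abs_ge0 //; exact: vC.
Qed.

HB.instance Definition _ := GRing.isSubringClosed.Build (nat -> rat)
  (padic_cauchy p) padic_cauchy_subring_closed.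

Record padicSeq := PadicSeq {
  padic_seq :> nat -> rat;
  padic_seqP : padic_seq \in padic_cauchy p }.

HB.instance Definition _ := [isSub for padic_seq].
HB.instance Definition _ := [Choice of padicSeq by <:].
HB.instance Definition _ := [SubChoice_isSubComNzRing of padicSeq by <:].

Definition padic_null : {pred padicSeq} := fun u =>
  `[< forall e : rat, 0 < e -> exists N : nat, forall n : nat,
        (N <= n)%N -> abs (u n) < e >].

Lemma padic_seqB (u v : padicSeq) n : (u - v) n = u n - v n.
Proof. by []. Qed.
Lemma padic_seqD (u v : padicSeq) n : (u + v) n = u n + v n.
Proof. by []. Qed.
Lemma padic_seqM (u v : padicSeq) n : (u * v) n = u n * v n.
Proof. by []. Qed.

Lemma padic_null_idealr_closed : idealr_closed padic_null.
Proof.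
split=> [||a u v].
- by apply/asboolP => e e0; exists 0%N => n _; rewrite padic_abs0.
- apply/negP => /asboolP /(_ 1 ltr01)[N /(_ N (leqnn N))].
  by rewrite padic_abs1 ltxx.
- move=> /asboolP uN /asboolP vN; apply/asboolP => e e0.
  have [B B0 [N1 aB]] := padic_cauchy_bounded (padic_seqP a).
  have [[N2 {}uN] [N3 {}vN]] := (uN (e / B) (divr_gt0 e0 B0), vN e e0).
  exists (maxn N1 (maxn N2 N3)) => n; rewrite !geq_max => /andP[? /andP[? ?]].
  rewrite padic_seqD padic_seqM (le_lt_trans (padic_absD _ _ _)) // gt_max.
  rewrite vN // andbT padic_absM.
  have := uN n; rewrite ltr_pdivlMr // mulrC => h.
  rewrite (le_lt_trans _ (h _)) // ler_wpM2r ?padic_abs_ge0 //; exact: aB.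
Qed.

HB.instance Definition _ := isIdealr.Build padicSeq padic_null
  padic_null_idealr_closed.

Lemma padic_seq_eventually (u : padicSeq) : u \notin padic_null ->
  exists2 c, 0 < c & exists N, forall n, (N <= n)%N -> abs (u n) = c.
Proof.
move=> /asboolPn /existsNP[e] /not_implyP[e0] /forallNP H.
have [N uN] := asboolP _ (padic_seqP u) e e0.
have /existsNP[n0] := H N => /not_implyP[Nn0] /negP; rewrite -leNgt => en0.
exists (abs (u n0)); first exact: lt_le_trans en0.
exists N => n Nn; apply: padic_abs_eq_lt; exact: lt_le_trans (uN _ _ _ _) en0.
Qed.

Definition padic_seq_inv (u : padicSeq) : padicSeq :=
  insubd 0 (fun n => (u n)^-1).

Lemma padic_seq_invE (u : padicSeq) : u \notin padic_null ->
  padic_seq_inv u = (fun n => (u n)^-1) :> (nat -> rat).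
Proof.
move=> u0; apply: insubdK; have [c c0 [N uc]] := padic_seq_eventually u0.
apply/asboolP => e e0.
have [M uM] := asboolP _ (padic_seqP u) (e * (c * c))
  (mulr_gt0 e0 (mulr_gt0 c0 c0)).
exists (maxn N M) => m n; rewrite !geq_max => /andP[Nm Mm] /andP[Nn Mn].
have um : u m != 0 by rewrite -(padic_abs_gt0 p) uc.
have un : u n != 0 by rewrite -(padic_abs_gt0 p) uc.
have -> : (u m)^-1 - (u n)^-1 = (u n - u m) / (u m * u n) by field; apply/andP.
by rewrite padic_absM padic_absV padic_absM !uc // ltr_pdivrMr ?mulr_gt0 ?uM.
Qed.

End PadicCauchy.

Arguments padic_null : clear implicits.

(* The completion of the rationals for the p-adic absolute value: Cauchy      *)
(* sequences modulo null sequences.                                           *)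
Definition Qp (p : nat) : Type := {ideal_quot (padic_null p)}.

Section Qp.
Variable p : nat.
Local Notation abs := (padic_abs p).
Local Open Scope quotient_scope.

HB.instance Definition _ := GRing.ComNzRing.on (Qp p).
HB.instance Definition _ := Quotient.on (Qp p).

Definition Qp_of_seq (u : padicSeq p) : Qp p := \pi_(Qp p) u.

Lemma Qp_of_seqK (x : Qp p) : Qp_of_seq (repr x) = x.
Proof. exact: reprK. Qed.

Lemma Qp_of_seq_eq0 u : (Qp_of_seq u == 0) = (u \in padic_null p).
Proof.
rewrite /Qp_of_seq.
by rewrite -[u in RHS]subr0 Quotient.idealrBE; congr (_ == _); rewrite !piE.
Qed.

Lemma Qp_of_seqD u v : Qp_of_seq (u + v) = Qp_of_seq u + Qp_of_seq v.
Proof. by rewrite /Qp_of_seq !piE. Qed.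
Lemma Qp_of_seqM u v : Qp_of_seq (u * v) = Qp_of_seq u * Qp_of_seq v.
Proof. by rewrite /Qp_of_seq !piE. Qed.
Lemma Qp_of_seqN u : Qp_of_seq (- u) = - Qp_of_seq u.
Proof. by rewrite /Qp_of_seq !piE. Qed.
Lemma Qp_of_seq1 : Qp_of_seq 1 = 1.
Proof. by rewrite /Qp_of_seq !piE. Qed.

Definition Qp_inv (x : Qp p) : Qp p :=
  if x == 0 then 0 else Qp_of_seq (padic_seq_inv (repr x)).

Lemma Qp_mulVx x : x != 0 -> Qp_inv x * x = 1.
Proof.
move=> x0; rewrite /Qp_inv (negPf x0) -{2}(Qp_of_seqK x).
move: x0; rewrite -{1}(Qp_of_seqK x) Qp_of_seq_eq0; set u := repr x => u0.
apply/eqP; rewrite -Qp_of_seqM -Qp_of_seq1 -subr_eq0 -Qp_of_seqN -Qp_of_seqD.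
rewrite Qp_of_seq_eq0; apply/asboolP => e e0.
have [c c0 [N uc]] := padic_seq_eventually u0; exists N => n Nn.
rewrite padic_seqB padic_seqM padic_seq_invE // mulVf ?subrr ?padic_abs0 //.
by rewrite -(padic_abs_gt0 p) uc.
Qed.

Lemma Qp_inv0 : Qp_inv 0 = 0. Proof. by rewrite /Qp_inv eqxx. Qed.

HB.instance Definition _ := GRing.ComNzRing_isField.Build (Qp p)
  Qp_mulVx Qp_inv0.

Definition Qp_abs (x : Qp p) : rat :=
  limn (fun n => (abs (repr x n) : rat^o)).

Let Qp_abs_cvg_aux (u : padicSeq p) (c : rat) :
  (c = 0 /\ u \in padic_null p \/
   0 < c /\ exists N, forall n, (N <= n)%N -> abs (u n) = c) ->
  (fun n => (abs (u n) : rat^o)) @ \oo --> (c : rat^o).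
Proof.
case=> [[-> /asboolP u0]|[c0 [N uN]]]; apply/cvgrPdist_lt => e e0.
  have [N uN] := u0 e e0; exists N => // n /= Nn.
  by rewrite sub0r normrN ger0_norm ?padic_abs_ge0 // uN.
by exists N => // n /= Nn; rewrite uN // subrr normr0.
Qed.

Let padic_seq_case (u : padicSeq p) : exists c : rat,
  c = 0 /\ u \in padic_null p \/
   0 < c /\ exists N, forall n, (N <= n)%N -> abs (u n) = c.
Proof.
have [u0|/padic_seq_eventually[c c0 Hc]] := boolP (u \in padic_null p).
  by exists 0; left.
by exists c; right.
Qed.

Lemma Qp_abs_case (u : padicSeq p) :
  (u \in padic_null p /\ Qp_abs (Qp_of_seq u) = 0) \/
  (0 < Qp_abs (Qp_of_seq u) /\
   exists N, forall n, (N <= n)%N -> abs (u n) = Qp_abs (Qp_of_seq u)).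
Proof.
set v := repr (Qp_of_seq u).
have uv : u - v \in padic_null p.
  rewrite -Qp_of_seq_eq0 Qp_of_seqD Qp_of_seqN Qp_of_seqK subrr eqxx //.
have [c Hc] := padic_seq_case v.
have -> : Qp_abs (Qp_of_seq u) = c.
  by apply: cvg_lim (Qp_abs_cvg_aux Hc).
case: Hc => [[c0 v0]|[c0 [N vN]]]; [left|right]; split => //.
  by rewrite -[u](subrK v) rpredD.
move: uv => /asboolP /(_ _ c0)[M uM]; exists (maxn N M) => n.
rewrite geq_max => /andP[Nn Mn]; rewrite -(vN n) //; apply: padic_abs_eq_lt.
by rewrite padic_abs_distC vN // uM.
Qed.

Lemma Qp_abs_cvg (u : padicSeq p) :
  (fun n => (abs (u n) : rat^o)) @ \oo --> (Qp_abs (Qp_of_seq u) : rat^o).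
Proof. by apply: Qp_abs_cvg_aux; case: (Qp_abs_case u) => [[]|]; auto. Qed.

Lemma Qp_abs_ge0 x : 0 <= Qp_abs x.
Proof. by rewrite -(Qp_of_seqK x); case: (Qp_abs_case (repr x)) => [[_ ->]|[/ltW]]. Qed.

Lemma Qp_abs_eq0 x : (Qp_abs x == 0) = (x == 0).
Proof.
rewrite -(Qp_of_seqK x) Qp_of_seq_eq0; set u := repr x.
have [[-> ->]|[c0 [N uN]]] := Qp_abs_case u; first by rewrite eqxx.
rewrite gt_eqF //; apply/esym/negP => /asboolP /(_ _ c0)[M uM].
by have := uM _ (leq_maxr N M); rewrite uN ?leq_maxl // ltxx.
Qed.

Lemma Qp_abs0 : Qp_abs 0 = 0. Proof. by apply/eqP; rewrite Qp_abs_eq0. Qed.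

Let rat_cvg_unique (f : nat -> rat) (a b : rat) :
  (f : nat -> rat^o) @ \oo --> (a : rat^o) ->
  (f : nat -> rat^o) @ \oo --> (b : rat^o) -> a = b.
Proof.
by move=> fa fb; rewrite -(cvg_lim _ fa) // -(cvg_lim _ fb).
Qed.

Lemma Qp_absN x : Qp_abs (- x) = Qp_abs x.
Proof.
rewrite -(Qp_of_seqK x) -Qp_of_seqN; set u := repr x.
apply: (@rat_cvg_unique (fun n => abs ((- u) n))); first exact: Qp_abs_cvg.
have -> : (fun n => abs ((- u) n)) = (fun n => abs (u n)).
  by apply/funext => n; rewrite -[RHS]padic_absN.
exact: Qp_abs_cvg u.
Qed.

Lemma Qp_abs_eventually (x : Qp p) : x != 0 ->
  exists N, forall n, (N <= n)%N -> abs (repr x n) = Qp_abs x.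
Proof.
move=> x0; have := Qp_abs_case (repr x); rewrite Qp_of_seqK => -[[]|[]//].
by rewrite -Qp_of_seq_eq0 Qp_of_seqK (negPf x0).
Qed.

Lemma Qp_absM x y : Qp_abs (x * y) = Qp_abs x * Qp_abs y.
Proof.
have [->|x0] := eqVneq x 0; first by rewrite mul0r Qp_abs0 mul0r.
have [->|y0] := eqVneq y 0; first by rewrite mulr0 Qp_abs0 mulr0.
have [N1 xN] := Qp_abs_eventually x0; have [N2 yN] := Qp_abs_eventually y0.
have := Qp_abs_case (repr x * repr y); rewrite Qp_of_seqM !Qp_of_seqK.
rewrite -Qp_of_seq_eq0 Qp_of_seqM !Qp_of_seqK mulf_eq0 (negPf x0) (negPf y0).
move=> -[[]//|[_ [N xyN]]]; pose n := maxn N (maxn N1 N2).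
have [Nn N1n N2n] : [/\ (N <= n)%N, (N1 <= n)%N & (N2 <= n)%N].
  by rewrite /n !leq_max !leqnn !orbT.
by rewrite -(xyN n) // -(xN n) // -(yN n) // -padic_absM.
Qed.

Lemma Qp_absD x y : Qp_abs (x + y) <= Num.max (Qp_abs x) (Qp_abs y).
Proof.
rewrite -(Qp_of_seqK x) -(Qp_of_seqK y) -Qp_of_seqD.
set u := repr x; set v := repr y; rewrite leNgt; apply/negP.
rewrite gt_max => /andP[].
have [[_ ->]|[c0 [N uN]]] := Qp_abs_case (u + v).
  by rewrite ltNge Qp_abs_ge0.
set c := Qp_abs _ in c0 uN * => ux vy.
have near w : Qp_abs (Qp_of_seq w) < c ->
    exists N, forall n, (N <= n)%N -> abs (w n) < c.
  move=> wc; have [[/asboolP /(_ _ c0)//]|[_ [M wM]]] := Qp_abs_case w.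
  by exists M => n /wM ->.
have [[N1 {}ux] [N2 {}vy]] := (near _ ux, near _ vy).
pose n := maxn N (maxn N1 N2).
have [Nn N1n N2n] : [/\ (N <= n)%N, (N1 <= n)%N & (N2 <= n)%N].
  by rewrite /n !leq_max !leqnn !orbT.
have := uN n Nn; rewrite padic_seqD => E.
have := padic_absD p (u n) (v n); rewrite E leNgt gt_max ux ?vy //.
Qed.

Definition Qp_dist (x y : Qp p) : rat := Qp_abs (x - y).

Lemma Qp_distxx x : Qp_dist x x = 0.
Proof. by rewrite /Qp_dist subrr Qp_abs0. Qed.

Lemma Qp_dist_positivity x y : Qp_dist x y = 0 -> x = y.
Proof. by move=> /eqP; rewrite Qp_abs_eq0 subr_eq0 => /eqP. Qed.

Lemma Qp_dist_sym x y : Qp_dist x y = Qp_dist y x.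
Proof. by rewrite /Qp_dist -Qp_absN opprB. Qed.

Lemma Qp_dist_triangle y x z : Qp_dist x z <= Qp_dist x y + Qp_dist y z.
Proof.
rewrite /Qp_dist -[x - z](subrKA y) (le_trans (Qp_absD _ _)) // ge_max.
by rewrite lerDl lerDr !Qp_abs_ge0.
Qed.

HB.instance Definition _ := isMetric.Build rat (Qp p)
  Qp_distxx Qp_dist_positivity Qp_dist_sym Qp_dist_triangle.

Definition padic_cst (q : rat) : padicSeq p.
Proof.
exists (fun=> q); apply/asboolP => e e0; exists 0%N => m n _ _.
by rewrite subrr padic_abs0.
Defined.

Lemma ratr_Qp (q : rat) : ratr q = Qp_of_seq (padic_cst q).
Proof.
have cstD a b : padic_cst (a + b) = padic_cst a + padic_cst b.
  exact: val_inj.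
have cstM a b : padic_cst (a * b) = padic_cst a * padic_cst b.
  exact: val_inj.
have cstN a : padic_cst (- a) = - padic_cst a by exact: val_inj.
have nat_cst n : Qp_of_seq (padic_cst n%:R) = n%:R.
  elim: n => [|n IHn].
    apply/eqP; rewrite Qp_of_seq_eq0 (_ : padic_cst 0 = 0) ?rpred0 //.
    exact: val_inj.
  rewrite -natr1 cstD Qp_of_seqD IHn (_ : padic_cst 1 = 1); last exact: val_inj.
  by rewrite Qp_of_seq1 natr1.
have int_cst (n : int) : Qp_of_seq (padic_cst n%:~R) = n%:~R.
  by case: n => n; rewrite ?NegzE ?rmorphN /= ?cstN ?Qp_of_seqN nat_cst.
have d0 : (denq q)%:~R != 0 :> Qp p.
  rewrite -int_cst Qp_of_seq_eq0; apply/negP => /asboolP.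
  have c0 : 0 < abs (denq q)%:~R by rewrite padic_abs_gt0 intr_eq0 denq_eq0.
  by move=> /(_ _ c0)[N /(_ N (leqnn N))]; rewrite ltxx.
apply: (mulIf d0); rewrite /ratr divfK // -(int_cst (numq q)) -(int_cst (denq q)).
by rewrite numqE cstM Qp_of_seqM.
Qed.

Lemma Qp_abs_ratr (q : rat) : Qp_abs (ratr q) = abs q.
Proof.
rewrite ratr_Qp; apply/esym.
apply: (@rat_cvg_unique (fun=> abs q)); first exact: cvg_cst.
exact: Qp_abs_cvg (padic_cst q).
Qed.

Lemma mdist_QpE (x y : Qp p) : mdist x y = Qp_abs (x - y).
Proof. by []. Qed.

Lemma dense_Qp_rat : dense (range (ratr : rat -> Qp p)).
Proof.
move=> O [x Ox] /(_ _ Ox); rewrite /= -nbhs_ballE => -[e /= e0 xeO].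
set u := repr x; have [N uN] := asboolP _ (padic_seqP u) e e0.
exists (ratr (u N)); split; last by exists (u N).
apply: xeO; rewrite ballEmdist /= mdist_QpE ratr_Qp -(Qp_of_seqK x).
rewrite -Qp_of_seqN -Qp_of_seqD; set v := u - padic_cst (u N).
have [[_ ->]//|[_ [M vM]]] := Qp_abs_case v.
by rewrite -(vM (maxn M N)) ?leq_maxl // padic_seqB uN ?leq_maxr.
Qed.

End Qp.

Section Densities.
Variable R : realType.

Definition count_upto (A : set nat) (n : nat) : nat :=
  (\sum_(1 <= k < n.+1 | k \in A) 1)%N.

Definition lower_density (A : set nat) : R :=
  limn_inf (fun n : nat => (count_upto A n)%:R / n%:R : R).

Definition upper_density (A : set nat) : R :=
  limn_sup (fun n : nat => (count_upto A n)%:R / n%:R : R).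

End Densities.

Definition ratio_set (p : nat) (A : set nat) : set (Qp p) :=
  [set x | exists a a' : nat, [/\ A a, A a' & x = a%:R / a'%:R]].

Arguments ratio_set : clear implicits.

(* Main.v *)
Require Import Defs.
From HB Require Import structures.
From mathcomp Require Import all_boot all_order all_algebra.
From mathcomp Require Import all_classical all_reals all_analysis.
From mathcomp Require Import lra zify.

Set Implicit Arguments.
Unset Strict Implicit.
Unset Printing Implicit Defensive.

Import Order.TTheory GRing.Theory Num.Theory.
Import numFieldNormedType.Exports.

Local Open Scope classical_set_scope.
Local Open Scope ring_scope.

(** (a) If the upper density is 1, then for any positive integers [m] and [n]
    some dilate [(m t, n t)] lies in [A * A]: for suitable large [N] the
    complement of [A] in [[1, N]] is too small to contain one of [m t], [n t]
    for every [t <= N / (m + n)].  Hence the ratio set contains every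
    positive rational, and these are dense in [Qp].

    (b) Remove from the positive integers the multiples of [q ^ (k + q)] for
    every prime [q].  At most [\sum_q N / q ^ (k + q) <= N / 2 ^ k] integers up
    to [N] are lost, while for each [p] the valuations of the remaining integers
    are bounded, so that their ratios stay away from 0 in [Qp]. *)

(** * Counting elements of a set and of its dilates up to a bound *)

Lemma count_uptoS (A : set nat) n :
  count_upto A n.+1 = (count_upto A n + (n.+1 \in A))%N.
Proof.
rewrite /count_upto big_mkcond big_nat_recr //= -big_mkcond /=.
by case: (n.+1 \in A).
Qed.

Lemma count_upto0 (A : set nat) : count_upto A 0 = 0%N.
Proof. by rewrite /count_upto big_geq. Qed.

Lemma count_uptoC (A : set nat) n :
  (count_upto A n + count_upto (~` A) n)%N = n.
Proof.
elim: n => [|n IHn]; first by rewrite !count_upto0.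
by rewrite !count_uptoS in_setC; case: (n.+1 \in A) => /=; lia.
Qed.

Lemma count_upto_leq (A : set nat) n : (count_upto A n <= n)%N.
Proof. by have := count_uptoC A n; lia. Qed.

Lemma leq_count_upto (A : set nat) m n :
  (m <= n)%N -> (count_upto A m <= count_upto A n)%N.
Proof.
move=> /subnK <-; elim: (n - m)%N => // d IHd.
by rewrite addSn count_uptoS (leq_trans IHd) ?leq_addr.
Qed.

(** Raising [n] by one adds a block of [m] integers on the right, whose last element is exactly the
    multiple tested on the left. *)
Lemma count_upto_preimage_mul (B : set nat) m n : (0 < m)%N ->
  (count_upto [set t | B (m * t)%N] n <= count_upto B (m * n))%N.
Proof.
case: m => // m _; elim: n => [|n IHn]; first by rewrite count_upto0.
rewrite count_uptoS mulnSr addnS count_uptoS; apply: leq_add.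
  by apply: leq_trans IHn (leq_count_upto _ _); rewrite leq_addr.
suff -> : (n.+1 \in [set t | B (m.+1 * t)%N]) = ((m.+1 * n + m).+1 \in B) by [].
by apply/asboolP/asboolP => /=; rewrite mulnSr addnS.
Qed.

Lemma count_upto_setU (B C : set nat) n :
  (count_upto (B `|` C) n <= count_upto B n + count_upto C n)%N.
Proof.
elim: n => [|n IHn]; first by rewrite !count_upto0.
by rewrite !count_uptoS in_setU; case: (_ \in B); case: (_ \in C) => /=; lia.
Qed.

Lemma no_common_dilate_leq (A : set nat) m n N : (0 < m)%N -> (0 < n)%N ->
  ~ (exists2 t, (0 < t)%N & A (m * t)%N /\ A (n * t)%N) ->
  (N %/ (m + n) <= 2 * count_upto (~` A) N)%N.
Proof.
move=> m0 n0 noA; set T := (N %/ (m + n))%N.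
pose B := [set t | (~` A) (m * t)%N]; pose C := [set t | (~` A) (n * t)%N].
have BC : count_upto (B `|` C) T = T.
  elim: T => [|T IHT]; first by rewrite count_upto0.
  rewrite count_uptoS IHT (_ : _ \in _) ?addn1 //; apply/asboolP.
  by apply/not_andP => h; apply: noA; exists T.+1.
have TN : ((m + n) * T <= N)%N by rewrite mulnC leq_divM.
rewrite -{1}BC (leq_trans (count_upto_setU _ _ _)) // mul2n -addnn.
apply: leq_add; apply: leq_trans (count_upto_preimage_mul _ _ _) _ => //;
  apply: leq_count_upto; nia.
Qed.

(** * From eventual bounds on frequencies to bounds on densities *)

Section DensityBounds.
Variable R : realType.
Implicit Types (A : set nat) (c : R).

Let freq A : nat -> R^o := fun n => (count_upto A n)%:R / n%:R.

Lemma freq_bounded A : bounded_fun (freq A).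
Proof.
exists 1; split=> // M M1 n _; rewrite /freq /= ger0_norm ?divr_ge0 //.
rewrite (le_trans _ (ltW M1)) //; case: n => [|n]; first by rewrite invr0 mulr0.
by rewrite ler_pdivrMr ?ltr0n // mul1r ler_nat count_upto_leq.
Qed.

Lemma upper_density_le A c N :
  (forall n, (N <= n)%N -> (count_upto A n)%:R / n%:R <= c) ->
  upper_density R A <= c.
Proof.
move=> h; rewrite /upper_density (limn_supE (freq_bounded A)).
apply: (@le_trans _ _ (sups (freq A) N)).
  apply: ge_inf; last by exists N.
  exact/bounded_fun_has_lbound_sups/freq_bounded.
apply: ge_sup; first by exists (freq A N), N => /=.
by move=> _ [n /= Nn <-]; exact: h.
Qed.

Lemma lower_density_ge A c N :
  (forall n, (N <= n)%N -> c <= (count_upto A n)%:R / n%:R) ->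
  c <= lower_density R A.
Proof.
move=> h; rewrite /lower_density (limn_infE (freq_bounded A)).
apply: (@le_trans _ _ (infs (freq A) N)).
  apply: lb_le_inf; first by exists (freq A N), N => /=.
  by move=> _ [n /= Nn <-]; exact: h.
apply: ub_le_sup; last by exists N.
exact/bounded_fun_has_ubound_infs/freq_bounded.
Qed.

Lemma common_dilate A m n : upper_density R A = 1 -> (0 < m)%N -> (0 < n)%N ->
  exists2 t, (0 < t)%N & A (m * t)%N /\ A (n * t)%N.
Proof.
move=> A1 m0 n0; apply: contrapT => noA.
(* For [N >= 2 * (m + n)] the floor [N %/ (m + n)] is at least [N / (2 * (m + n))]. The complement
   holds at least half as many elements, hence the factor 4. *)
suff : upper_density R A <= 1 - (4 * (m + n))%:R^-1.
  by rewrite A1 lerBrDr gerDl leNgt invr_gt0 ltr0n muln_gt0 addn_gt0 m0.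
apply: (@upper_density_le _ _ (2 * (m + n))) => N leN.
have N0 : (0 < N)%N by lia.
have M0 : (0 < m + n)%N by lia.
have key : (4 * (m + n) * count_upto A N + N <= 4 * (m + n) * N)%N.
  have := no_common_dilate_leq N m0 n0 noA.
  have := count_uptoC A N; have := ltn_ceil N M0.
  by move: (m + n)%N leN (N %/ _)%N => M leN q ltN eqN leq; nia.
have M4 : 0 < (4 * (m + n))%:R :> R by rewrite ltr0n muln_gt0.
rewrite ler_pdivrMr ?ltr0n // -(ler_pM2l M4) mulrA mulrBr mulr1 divff ?gt_eqF //.
by rewrite mulrBl mul1r lerBrDr -!natrM -natrD ler_nat.
Qed.

End DensityBounds.

(** * Ratios of positive integers in the [p]-adic metric *)

Section Qp_ratios.
Variable p : nat.

Lemma Qp_abs_nat n : Qp_abs (n%:R : Qp p) = padic_abs p n%:R.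
Proof. by rewrite -(ratr_nat (Qp p)) Qp_abs_ratr. Qed.

Lemma Qp_natr_eq0 n : (n%:R == 0 :> Qp p) = (n == 0%N).
Proof. by rewrite -Qp_abs_eq0 Qp_abs_nat padic_abs_eq0 pnatr_eq0. Qed.

Lemma padic_abs_nat n : (0 < n)%N -> padic_abs p n%:R = p%:R ^- logn p n.
Proof. by move=> n0; rewrite (@padic_abs_int p n) // -lt0n. Qed.

Lemma Qp_abs_divr_nat a b : (0 < a)%N -> (0 < b)%N ->
  Qp_abs (a%:R / b%:R : Qp p) = p%:R ^- logn p a * p%:R ^+ logn p b.
Proof.
move=> a0 b0; have bn0 : b%:R != 0 :> Qp p by rewrite Qp_natr_eq0 -lt0n.
have bb0 : padic_abs p b%:R != 0 by rewrite padic_abs_eq0 pnatr_eq0 -lt0n.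
apply: (mulIf bb0); rewrite -Qp_abs_nat -Qp_absM divfK // !Qp_abs_nat.
rewrite !padic_abs_nat // -mulrA divff ?mulr1 //.
by move: bb0; rewrite padic_abs_nat // invr_eq0.
Qed.

Hypothesis p_pr : prime p.

(** A rational [q] close to [x] may be negative or zero. Adding a large multiple of a high power of
    [p] makes it positive and moves it little [p]-adically. *)
Lemma Qp_pos_rat_dense (x : Qp p) (e : rat) : 0 < e ->
  exists m n : nat, [/\ (0 < m)%N, (0 < n)%N & Qp_abs (x - m%:R / n%:R) < e].
Proof.
move=> e0; have [y [xy [q _ qy]]] : (ball x e)° `&` range ratr !=set0.
  apply: dense_Qp_rat; last exact: open_interior.
  by exists x; exact: nbhsx_ballx.
move: xy => /interior_subset; rewrite -{}qy {y} ballEmdist /= mdist_QpE => xq.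
(* This gives [e^-1 < k < p ^ k], hence [p ^- k < e]. *)
pose k := Num.bound e^-1.
have pke : padic_abs p (p ^ k)%:R < e.
  rewrite padic_abs_nat ?expn_gt0 ?prime_gt0 // pfactorK //.
  rewrite invf_plt ?posrE ?exprn_gt0 ?ltr0n ?prime_gt0 // -natrX.
  apply: lt_trans (archi_boundP _) _; first by rewrite invr_ge0 ltW.
  by rewrite ltr_nat ltn_expl // prime_gt1.
(* [M] exceeds the absolute value of the numerator, so the numerator [m] of [q + p ^ k * M] is
   positive. *)
pose d := `|denq q|%N; pose M := (`|numq q|.+1)%N.
have d0 : (0 < d)%N by rewrite absz_gt0 denq_eq0.
have dE : denq q = d%:Z by rewrite gez0_abs // denq_ge0.
pose m := `|(numq q + (p ^ k * M * d)%N%:Z)%R|%N.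
have pk0 : (0 < p ^ k)%N by rewrite expn_gt0 prime_gt0.
have mE : m%:Z = numq q + (p ^ k * M * d)%N%:Z.
  rewrite /m gez0_abs //.
  have : (M <= p ^ k * M * d)%N by rewrite mulnAC leq_pmull ?muln_gt0 ?pk0.
  by rewrite /M; lia.
have m0 : (0 < m)%N.
  have : (M <= p ^ k * M * d)%N by rewrite mulnAC leq_pmull ?muln_gt0 ?pk0.
  by move: mE; rewrite /M; lia.
have dn0 : d%:R != 0 :> Qp p by rewrite Qp_natr_eq0 -lt0n.
exists m, d; split=> [//|//|].
have -> : m%:R / d%:R = ratr q + (p ^ k)%:R * M%:R :> Qp p.
  apply: (mulIf dn0); rewrite divfK // mulrDl -!natrM /ratr dE.
  by rewrite -[d%:~R]/(d%:R) divfK // -[m%:R]/(m%:~R) mE intrD.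
rewrite opprD addrA (le_lt_trans (Qp_absD _ _)) // gt_max xq /= Qp_absN.
rewrite Qp_absM !Qp_abs_nat (le_lt_trans _ pke) // ler_piMr ?padic_abs_ge0 //.
rewrite padic_abs_nat // invf_le1 ?exprn_gt0 ?ltr0n ?prime_gt0 //.
by rewrite -natrX ler1n expn_gt0 prime_gt0.
Qed.

Lemma dense_ratio_set (A : set nat) :
  (forall m n : nat, (0 < m)%N -> (0 < n)%N ->
     exists2 t, (0 < t)%N & A (m * t)%N /\ A (n * t)%N) ->
  dense (ratio_set p A).
Proof.
move=> HA O [x Ox] /(_ _ Ox); rewrite /= -nbhs_ballE => -[e /= e0 xeO].
have [m [n [m0 n0 xmn]]] := Qp_pos_rat_dense x e0.
have [t t0 [Am An]] := HA m n m0 n0.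
exists (m%:R / n%:R); split; first by apply: xeO; rewrite ballEmdist.
exists (m * t)%N, (n * t)%N; split => //.
by rewrite !natrM -mulf_div divff ?mulr1 // Qp_natr_eq0 -lt0n.
Qed.

(** The ball of radius [p ^- v] about 0 is missed: a numerator in [A] has absolute value at least
    [p ^- v], and dividing by a positive integer cannot decrease it. *)
Lemma not_dense_ratio_set (A : set nat) v : A `<=` [set n | (0 < n)%N] ->
  (forall n, A n -> (logn p n < v)%N) -> ~ dense (ratio_set p A).
Proof.
move=> Apos Av Ad; pose e : rat := p%:R ^- v.
have p0 : 0 < p%:R :> rat by rewrite ltr0n prime_gt0.
have e0 : 0 < e by rewrite invr_gt0 exprn_gt0.
have [] := Ad (ball (0 : Qp p) e)°; first by exists 0; exact: nbhsx_ballx.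
  exact: open_interior.
move=> y [/interior_subset + [a [b [Aa Ab yE]]]].
rewrite ballEmdist /= mdist_QpE sub0r Qp_absN yE.
rewrite Qp_abs_divr_nat; [|exact: Apos..]; apply/negP; rewrite -leNgt /e.
rewrite -[X in X <= _]mulr1 ler_pM ?invr_ge0 ?exprn_ge0 ?ler0n //.
  rewrite lef_pV2 ?posrE ?exprn_gt0 // ler_weXn2l ?ler1n ?prime_gt0 //.
  exact/ltnW/Av.
by rewrite exprn_ege1 // ler1n prime_gt0.
Qed.

End Qp_ratios.

(** * The set used for (b) and its lower density *)

Definition high_power_free (k : nat) : set nat :=
  [set n | (0 < n)%N /\ forall q, prime q -> ~~ (q ^ (k + q) %| n)%N].

Lemma high_power_free_logn k p n : prime p -> high_power_free k n ->
  (logn p n < k + p)%N.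
Proof.
by move=> p_pr [n0 /(_ p p_pr)]; rewrite ltnNge pfactor_dvdn.
Qed.

(** Union bound: count the pairs of a prime [q] and a multiple [x] of [q ^ (k + q)], exchange the
    two sums, and use [2 <= q]. *)
Lemma count_not_high_power_free k n :
  (count_upto (~` high_power_free k) n <=
   \sum_(1 <= q < n.+1) n %/ 2 ^ (k + q))%N.
Proof.
have leD q : (0 < q)%N ->
    (\sum_(1 <= x < n.+1) (prime q && (q ^ (k + q) %| x)) <= n %/ 2 ^ (k + q))%N.
  move=> q0; have [q_pr|_] := boolP (prime q); last by rewrite big1.
  rewrite /= -divn_count_dvd leq_div2l ?expn_gt0 // leq_exp2r ?prime_gt1 //.
  by rewrite addn_gt0 q0 orbT.
apply: (@leq_trans (\sum_(1 <= q < n.+1) \sum_(1 <= x < n.+1)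
    (prime q && (q ^ (k + q) %| x)))%N); last first.
  by rewrite big_nat [leqRHS]big_nat leq_sum // => q /andP[/leD].
rewrite exchange_big /= /count_upto big_mkcond big_nat [leqRHS]big_nat.
apply: leq_sum => x /andP[x0 xn].
case: ifP => // /asboolP /not_andP[//|/existsNP[q] /not_implyP[q_pr] /negP].
rewrite negbK => qx.
(* Since [q < q ^ q <= q ^ (k + q) <= x <= n], cutting the sum at [n] misses no relevant prime. *)
have qn : (q <= n)%N.
  rewrite -ltnS; apply: leq_trans xn; rewrite ltnS.
  apply: leq_trans (dvdn_leq x0 qx).
  rewrite (leq_trans (ltnW (ltn_expl q (prime_gt1 q_pr)))) //.
  by rewrite leq_exp2l ?prime_gt1 ?leq_addl.
have q_in : q \in index_iota 1 n.+1 by rewrite mem_index_iota prime_gt0.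
by rewrite (bigD1_seq q q_in (iota_uniq _ _)) /= q_pr qx leq_addr.
Qed.

Lemma high_power_free_lower_density (R : realType) k :
  1 - 2^-k <= lower_density R (high_power_free k).
Proof.
(* Starting at 1 avoids [n = 0], where the quotient is 0 by convention. *)
apply: (@lower_density_ge _ _ _ 1) => n n0.
have nR0 : 0 < n%:R :> R by rewrite ltr0n.
rewrite ler_pdivlMr //.
have := congr1 (fun i => i%:R : R) (count_uptoC (high_power_free k) n).
rewrite /= natrD => eqn.
suff : (count_upto (~` high_power_free k) n)%:R <= 2^-k * n%:R :> R by lra.
have geom N : \sum_(1 <= q < N.+1) 2^-q = 1 - 2^-N :> R.
  elim: N => [|N IHN]; first by rewrite big_geq // expr0 invr1 subrr.
  rewrite big_nat_recr //= IHN exprS invfM; lra.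
apply: (@le_trans _ _ (\sum_(1 <= q < n.+1) 2^-k * n%:R * 2^-q)).
  apply: le_trans (_ : (\sum_(1 <= q < n.+1) n %/ 2 ^ (k + q))%:R <= _).
    by rewrite ler_nat count_not_high_power_free.
  rewrite natr_sum ler_sum // => q _.
  rewrite mulrAC -invfM -exprD mulrC ler_pdivlMr ?exprn_gt0 //.
  by rewrite -natrX -natrM ler_nat leq_divM.
rewrite -mulr_sumr geom ler_piMr ?mulr_ge0 ?invr_ge0 ?exprn_ge0 //.
Qed.

Theorem theorem3p4 (R : realType) :
  (forall A : set nat, A `<=` [set n | (0 < n)%N] ->
     upper_density R A = 1 ->
     forall p : nat, prime p -> dense (ratio_set p A)) /\
  (forall alpha : R, 0 <= alpha < 1 ->
     exists A : set nat, [/\ A `<=` [set n | (0 < n)%N],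
       alpha <= lower_density R A &
       forall p : nat, prime p -> ~ dense (ratio_set p A)]).
Proof.
split=> [A _ A1 p p_pr|alpha /andP[_ alpha1]].
  by apply: dense_ratio_set => // m n; exact: common_dilate A1.
have a0 : 0 < 1 - alpha by rewrite subr_gt0.
(* Here [(1 - alpha)^-1 < k < 2 ^ k], so the lost proportion [2^-k] is below [1 - alpha]. *)
pose k := Num.bound (1 - alpha)^-1; exists (high_power_free k); split.
- by move=> n [].
- apply: le_trans (high_power_free_lower_density R k).
  rewrite lerBrDl -lerBrDr invf_ple ?posrE ?exprn_gt0 //.
  apply/ltW/(lt_trans (archi_boundP _)); first by rewrite invr_ge0 ltW.
  by rewrite -natrX ltr_nat ltn_expl.
- move=> p p_pr; apply: (@not_dense_ratio_set p p_pr _ (k + p)).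
    by move=> n [].
  by move=> n; exact: high_power_free_logn.
Qed.
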